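(* Let $X$ be a set and $M(X)$ the set of all multirelations over $X$. Then (1) $(M(X),\cup,\cdot,\|,\emptyset,1_\sigma,1_\pi,d)$ is a dp-trioid, and (2) $(M(X),\cup,\cdot,\|,\emptyset,1_\sigma,1_\pi,a)$ is an ap-trioid.
   Context: A multirelation over $X$ is a subset of $X\times 2^X$. For multirelations $R,S$: $R\cdot S=\{(a,A)\mid \exists B.\,(a,B)\in R\wedge\exists f:B\to 2^X.\,(\forall b\in B.\,(b,f(b))\in S)\wedge A=\bigcup_{b\in B}f(b)\}$; $1_\sigma=\{(a,\{a\})\mid a\in X\}$; $R\|S=\{(a,A\cup B)\mid (a,A)\in R,(a,B)\in S\}$; $1_\pi=\{(a,\emptyset)\mid a\in X\}$; $d(R)=\{(a,\{a\})\mid \exists A.\,(a,A)\in R\}$; $a(R)=\{(a,\{a\})\mid \neg\exists A.\,(a,A)\in R\}$. A proto-dioid is a structure $(S,+,\cdot,0,1_\sigma)$ such that $+$ is associative, commutative, idempotent with unit $0$ (order $x\le y\iff x+y=y$) and $1_\sigma\cdot x=x$, $x\cdot 1_\sigma=x$, $x\cdot y+x\cdot z\le x\cdot(y+z)$, $(x+y)\cdot z=x\cdot z+y\cdot z$, $0\cdot x=0$. A proto-trioid $(S,+,\cdot,\|,0,1_\sigma,1_\pi)$ is a proto-dioid with $\|$ associative, commutative, unit $1_\pi$, $x\|(y+z)=x\|y+x\|z$, $x\|0=0$. A dp-trioid is a proto-trioid with unary $d$ satisfying: $x\cdot(y\cdot z)=(x\cdot y)\cdot z$ whenever one of $x,y,z$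 is of the form $d(w)$; $x\le d(x)\cdot x$; $d(x\cdot y)=d(x\cdot d(y))$; $d(x+y)=d(x)+d(y)$; $d(x)\le1_\sigma$; $d(0)=0$; $(x\|y)\cdot d(z)=(x\cdot d(z))\|(y\cdot d(z))$; $d(x\|y)=d(x)\cdot d(y)$; $d(x)\|d(y)=d(x)\cdot d(y)$. An ap-trioid is a proto-trioid with unary $a$ satisfying: $x\cdot(y\cdot z)=(x\cdot y)\cdot z$ whenever one of $x,y,z$ is of the form $a(w)$; $a(x)\cdot x=0$; $a(x\cdot y)=a(x\cdot a(a(y)))$; $a(x)+a(a(x))=1_\sigma$; $a(x)\cdot(y+z)=a(x)\cdot y+a(x)\cdot z$; $(x\|y)\cdot a(z)=(x\cdot a(z))\|(y\cdot a(z))$; $a(x\|y)=a(x)+a(y)$; $a(x)\|a(y)=a(x)\cdot a(y)$. *)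

(* Defs.v *)
From mathcomp Require Import all_boot.
From mathcomp Require Import boolp classical_sets.
Set Implicit Arguments.
Unset Strict Implicit.
Unset Printing Implicit Defensive.

Local Open Scope classical_set_scope.

Definition add_le (T : Type) (add : T -> T -> T) (x y : T) : Prop := add x y = y.

Record proto_dioid (T : Type) (add mul : T -> T -> T) (zero one : T) : Prop := {
  pd_addA : associative add;
  pd_addC : commutative add;
  pd_addxx : forall x, add x x = x;
  pd_add0x : left_id zero add;
  pd_mul1x : left_id one mul;
  pd_mulx1 : right_id one mul;
  pd_mul_subdistr : forall x y z,
    add_le add (add (mul x y) (mul x z)) (mul x (add y z));
  pd_mulDl : left_distributive mul add;
  pd_mul0x : left_zero zero mul
}.

Record proto_trioid (T : Type) (add mul par : T -> T -> T)
    (zero one pone : T) : Prop := {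
  pt_proto_dioid : proto_dioid add mul zero one;
  pt_parA : associative par;
  pt_parC : commutative par;
  pt_par1x : left_id pone par;
  pt_parDr : right_distributive par add;
  pt_parx0 : right_zero zero par
}.

Record dp_trioid (T : Type) (add mul par : T -> T -> T) (zero one pone : T)
    (d : T -> T) : Prop := {
  dp_proto_trioid : proto_trioid add mul par zero one pone;
  dp_mulA : forall x y z, (exists w, x = d w \/ y = d w \/ z = d w) ->
    mul x (mul y z) = mul (mul x y) z;
  dp_le_dmul : forall x, add_le add x (mul (d x) x);
  dp_d_loc : forall x y, d (mul x y) = d (mul x (d y));
  dp_dD : forall x y, d (add x y) = add (d x) (d y);
  dp_d_le1 : forall x, add_le add (d x) one;
  dp_d0 : d zero = zero;
  dp_par_muld : forall x y z,
    mul (par x y) (d z) = par (mul x (d z)) (mul y (d z));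
  dp_d_par : forall x y, d (par x y) = mul (d x) (d y);
  dp_par_dd : forall x y, par (d x) (d y) = mul (d x) (d y)
}.

Record ap_trioid (T : Type) (add mul par : T -> T -> T) (zero one pone : T)
    (a : T -> T) : Prop := {
  ap_proto_trioid : proto_trioid add mul par zero one pone;
  ap_mulA : forall x y z, (exists w, x = a w \/ y = a w \/ z = a w) ->
    mul x (mul y z) = mul (mul x y) z;
  ap_amulx : forall x, mul (a x) x = zero;
  ap_a_loc : forall x y, a (mul x y) = a (mul x (a (a y)));
  ap_compl : forall x, add (a x) (a (a x)) = one;
  ap_amulDr : forall x y z,
    mul (a x) (add y z) = add (mul (a x) y) (mul (a x) z);
  ap_par_mula : forall x y z,
    mul (par x y) (a z) = par (mul x (a z)) (mul y (a z));
  ap_a_par : forall x y, a (par x y) = add (a x) (a y);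
  ap_par_aa : forall x y, par (a x) (a y) = mul (a x) (a y)
}.

Definition multirel (X : Type) : Type := set (X * set X).

Section Multirelations.
Variable X : Type.
Implicit Types R S : multirel X.

Definition mr_union R S : multirel X := R `|` S.

Definition mr_empty : multirel X := set0.

(* [f] is a function on the subtype of elements of [B], not on all of [X]. *)
Definition mr_comp R S : multirel X :=
  [set p | exists B : set X, R (p.1, B) /\
    exists f : B -> set X, (forall b : B, S (val b, f b)) /\
      p.2 = \bigcup_(b in [set: B]) f b].

Definition mr_sid : multirel X := [set p | p.2 = [set p.1]].

Definition mr_par R S : multirel X :=
  [set p | exists A B : set X, [/\ R (p.1, A), S (p.1, B) & p.2 = A `|` B]].

Definition mr_pid : multirel X := [set p | p.2 = set0].

Definition mr_dom R : multirel X :=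
  [set p | p.2 = [set p.1] /\ exists A : set X, R (p.1, A)].

Definition mr_antidom R : multirel X :=
  [set p | p.2 = [set p.1] /\ ~ exists A : set X, R (p.1, A)].

End Multirelations.

(* Main.v *)
Require Import Defs.
From mathcomp Require Import all_boot.
From mathcomp Require Import boolp classical_sets.

(** Every value of [mr_dom] and [mr_antidom] is a subidentity, determined by the
    set [P] of points it contains.  Composing with it on the left restricts the
    source to [P], and composing with it on the right keeps the pairs whose
    target set is included in [P].  With these two descriptions each axiom
    becomes an elementary statement about points and sets; choice is needed
    only for the locality axioms, to pick a successor set for every point. *)

Set Implicit Arguments.
Unset Strict Implicit.
Unset Printing Implicit Defensive.

Local Open Scope classical_set_scope.

(** * Subidentities, their supports, and pointwise forms of composition *)

Definition mr_support (X : Type) (R : multirel X) : set X :=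
  [set x | exists A, R (x, A)].

Definition mr_test (X : Type) (P : set X) : multirel X :=
  [set p | p.2 = [set p.1] /\ P p.1].

Section MultirelationAlgebra.
Variable X : Type.
Implicit Types (R S T : multirel X) (P Q : set X).

Lemma multirel_ext R S : (forall x A, R (x, A) <-> S (x, A)) -> R = S.
Proof. by move=> RS; apply/seteqP; split=> -[x A] /RS. Qed.

(* The choice function of [mr_comp] may be taken total on [X]. *)
Lemma mr_compP R S x A :
  mr_comp R S (x, A) <->
  exists2 B, R (x, B) & exists2 f : X -> set X,
    (forall b, B b -> S (b, f b)) & A = \bigcup_(b in B) f b.
Proof.
split=> [[B /= [RxB [f [Sf ->]]]]|[B RxB [f Sf ->]]].
  exists B => //.
  (* At most one [c] lies over [b], so this union is [f c] on [B] and empty elsewhere; no case split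
     on membership in [B] is needed. *)
  pose g b : set X := [set y | exists2 c : B, val c = b & f c y].
  have gE (c : B) : g (val c) = f c.
    by apply/seteqP; split=> [y [c' /val_inj ->]|y fy] //; exists c.
  exists g => [b /mem_set Bb|].
    by have := Sf (exist _ b Bb); rewrite -gE.
  apply/seteqP; split=> [y [c _ fcy]|y [b _ [c _ fcy]]]; last by exists c.
  by exists (val c); [exact: set_mem (valP c)|rewrite gE].
exists B; split=> //; exists (f \o val); split.
  by move=> b; apply: Sf; exact: set_mem (valP b).
apply/seteqP; split=> y /= [b Bb fby]; last first.
  by exists (val b) => //; exact: set_mem (valP b).
by exists (exist _ b (mem_set Bb)).
Qed.

Lemma mr_domE R : mr_dom R = mr_test (mr_support R).
Proof. by []. Qed.

Lemma mr_antidomE R : mr_antidom R = mr_test (~` mr_support R).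
Proof. by []. Qed.

Lemma mr_sidE : mr_sid (X := X) = mr_test setT.
Proof. by apply: multirel_ext => x A; split=> [|[]]. Qed.

(** With this, applying [mr_antidom] twice becomes a double complement of the support. *)
Lemma mr_support_test P : mr_support (mr_test P) = P.
Proof. by apply/seteqP; split=> [x [A []]|x Px] //; exists [set x]. Qed.

Lemma mr_test_compP P R x A :
  mr_comp (mr_test P) R (x, A) <-> P x /\ R (x, A).
Proof.
rewrite mr_compP; split=> [[B [/= -> Px] [f Rf ->]]|[Px RxA]].
  by rewrite bigcup_set1; split=> //; exact: Rf.
exists [set x] => //; exists (fun=> A) => [b ->|] //.
by rewrite bigcup_set1.
Qed.

(** The test forces [f b = [set b]], so the union of the chosen sets gives back the intermediate set
    itself. *)
Lemma mr_comp_testP R P x A :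
  mr_comp R (mr_test P) (x, A) <-> R (x, A) /\ A `<=` P.
Proof.
rewrite mr_compP; split=> [[B RxB [f tf ->]]|[RxA AP]].
  have -> : \bigcup_(b in B) f b = B.
    apply/seteqP; split=> [y [b Bb]|y By].
      by have [/= -> _] := tf b Bb; move=> ->.
    by exists y => //; have [/= -> _] := tf y By.
  by split=> // b /tf[].
exists A => //; exists (fun b => [set b]) => [b /AP|] //.
by apply/seteqP; split=> [y Ay|y [b Ab ->]] //; exists y.
Qed.

(** * Associativity of composition with a subidentity among the factors *)

Lemma mr_test_compA P R S :
  mr_comp (mr_test P) (mr_comp R S) = mr_comp (mr_comp (mr_test P) R) S.
Proof.
apply: multirel_ext => x A; rewrite mr_test_compP !mr_compP; split.
  by move=> [Px [B RxB Sf]]; exists B => //; apply/mr_test_compP.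
by move=> [B /mr_test_compP[Px RxB] Sf]; split=> //; exists B.
Qed.

(** On either side [P] constrains only the intermediate set [B]: choosing successors through the
    test requires [P] at each point of [B], which is [B] included in [P]. *)
Lemma mr_comp_testA R P S :
  mr_comp R (mr_comp (mr_test P) S) = mr_comp (mr_comp R (mr_test P)) S.
Proof.
apply: multirel_ext => x A; rewrite !mr_compP; split.
  move=> [B RxB [f Sf ->]]; exists B; last first.
    by exists f => // b /Sf/mr_test_compP[].
  by apply/mr_comp_testP; split=> // b /Sf/mr_test_compP[].
move=> [B /mr_comp_testP[RxB BP] [f Sf ->]]; exists B => //; exists f => // b Bb.
by apply/mr_test_compP; split; [exact: BP|exact: Sf].
Qed.

(** A union of chosen sets is included in [P] exactly when each of them is. *)
Lemma mr_compA_test R S P :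
  mr_comp R (mr_comp S (mr_test P)) = mr_comp (mr_comp R S) (mr_test P).
Proof.
apply: multirel_ext => x A; rewrite mr_comp_testP !mr_compP; split.
  move=> [B RxB [f Sf ->]]; split; last by move=> y [b /Sf/mr_comp_testP[_]]; apply.
  by exists B => //; exists f => // b /Sf/mr_comp_testP[].
move=> [[B RxB [f Sf ->]] fP]; exists B => //; exists f => // b Bb.
by apply/mr_comp_testP; split=> [|y fby]; [exact: Sf|apply: fP; exists b].
Qed.

Lemma mr_compA_of_test R S T :
  (exists P, R = mr_test P \/ S = mr_test P \/ T = mr_test P) ->
  mr_comp R (mr_comp S T) = mr_comp (mr_comp R S) T.
Proof.
move=> [P [->|[->|->]]].
- exact: mr_test_compA.
- exact: mr_comp_testA.
- exact: mr_compA_test.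
Qed.

(** * Distributivity and monotonicity of composition *)

Lemma mr_compDl : left_distributive (@mr_comp X) (@mr_union X).
Proof.
move=> R S T; apply: multirel_ext => x A; split.
  by move=> /mr_compP[B [RxB|SxB] Tf]; [left|right]; apply/mr_compP; exists B.
by move=> [] /mr_compP[B RxB Tf]; apply/mr_compP; exists B => //; [left|right].
Qed.

Lemma mr_comp_mono R S T : S `<=` T -> mr_comp R S `<=` mr_comp R T.
Proof.
move=> ST [x A] /mr_compP[B RxB [f Sf ->]]; apply/mr_compP.
by exists B => //; exists f => // b /Sf/ST.
Qed.

(** A test leads from [x] to the single point [x], so only one successor set is chosen, in [R] or in
    [S]. With several points the choices could mix the two. *)
Lemma mr_test_compDr P R S :
  mr_comp (mr_test P) (mr_union R S) =
  mr_union (mr_comp (mr_test P) R) (mr_comp (mr_test P) S).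
Proof.
apply: multirel_ext => x A; split.
  by move=> /mr_test_compP[Px [Rx|Sx]]; [left|right]; apply/mr_test_compP.
by move=> [] /mr_test_compP[Px Rx]; apply/mr_test_compP; split=> //; [left|right].
Qed.

(** * Supports of compound multirelations and operations on subidentities *)

(** Both supports consist of the points with an [R]-successor set inside the support of [S]. This is
    the common core of the locality axioms for [d] and [a]. *)
Lemma mr_comp_support R S :
  mr_support (mr_comp R S) = mr_support (mr_comp R (mr_test (mr_support S))).
Proof.
apply/seteqP; split=> x [A].
  move=> /mr_compP[B RxB [f Sf _]]; exists B; apply/mr_comp_testP.
  by split=> // b /Sf; exists (f b).
move=> /mr_comp_testP[RxA AS].
have [f Sf] : exists f : X -> set X, forall b, A b -> S (b, f b).
  (* Choice asks for a value at every point of [X]; outside [A] the condition is vacuous and [set0]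
     serves as default. *)
  suff /choice[f Sf] b : exists C, A b -> S (b, C) by exists f.
  have [/AS[C SbC]|nAb] := pselect (A b); first by exists C.
  by exists set0.
by exists (\bigcup_(b in A) f b); apply/mr_compP; exists A => //; exists f.
Qed.

Lemma mr_support_union R S :
  mr_support (mr_union R S) = mr_support R `|` mr_support S.
Proof.
apply/seteqP; split=> x; first by move=> [A [RxA|SxA]]; [left|right]; exists A.
by move=> [] [A RxA]; exists A; [left|right].
Qed.

Lemma mr_support_par R S :
  mr_support (mr_par R S) = mr_support R `&` mr_support S.
Proof.
apply/seteqP; split=> [x [C [A [B [RxA SxB _]]]]|x [[A RxA] [B SxB]]].
  by split; [exists A|exists B].
by exists (A `|` B), A, B.
Qed.

Lemma mr_test_union P Q : mr_test (P `|` Q) = mr_union (mr_test P) (mr_test Q).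
Proof.
apply: multirel_ext => x A; split; first by move=> [/= -> []]; [left|right].
by move=> [] [/= -> Px]; split=> //; [left|right].
Qed.

Lemma mr_test_comp P Q : mr_comp (mr_test P) (mr_test Q) = mr_test (P `&` Q).
Proof.
apply: multirel_ext => x A; rewrite mr_test_compP.
by split=> [[Px [/= -> Qx]]|[/= -> [Px Qx]]].
Qed.

Lemma mr_test_par P Q : mr_par (mr_test P) (mr_test Q) = mr_test (P `&` Q).
Proof.
apply: multirel_ext => x A; split.
  by move=> [B [C /= [[/= -> Px] [/= -> Qx] ->]]]; rewrite setUid.
by move=> [/= -> [Px Qx]]; exists [set x], [set x]; rewrite setUid.
Qed.

(** The test bounds the target set, and a union lies in [P] exactly when both parts do. *)
Lemma mr_par_comp_test R S P :
  mr_comp (mr_par R S) (mr_test P) =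
  mr_par (mr_comp R (mr_test P)) (mr_comp S (mr_test P)).
Proof.
apply: multirel_ext => x A; split.
  move=> /mr_comp_testP[[B [C /= [RxB SxC ->]]]].
  rewrite subUset => -[BP CP].
  by exists B, C; split=> //; apply/mr_comp_testP.
move=> [B [C /= [/mr_comp_testP[RxB BP] /mr_comp_testP[SxC CP] ->]]].
by apply/mr_comp_testP; split; [exists B, C|rewrite subUset].
Qed.

(** * The proto-dioid and proto-trioid axioms *)

Lemma mr_proto_dioid :
  proto_dioid (@mr_union X) (@mr_comp X) (@mr_empty X) (@mr_sid X).
Proof.
split.
- exact: setUA.
- exact: setUC.
- exact: setUid.
- exact: set0U.
- move=> R; rewrite mr_sidE; apply: multirel_ext => x A.
  by rewrite mr_test_compP; split=> [[]|].
- move=> R; rewrite mr_sidE; apply: multirel_ext => x A.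
  by rewrite mr_comp_testP; split=> [[]|].
(* The order [add_le] is inclusion here, so subdistributivity reduces to monotonicity in the right
   factor. *)
- move=> R S T; apply/setUidPr; rewrite subUset; split; apply: mr_comp_mono.
    exact: subsetUl.
  exact: subsetUr.
- exact: mr_compDl.
- by move=> R; apply: multirel_ext => x A; split=> // /mr_compP[].
Qed.

Lemma mr_parC : commutative (@mr_par X).
Proof.
move=> R S; apply: multirel_ext => x A.
by split=> -[B [C /= [RxB SxC ->]]]; exists C, B; rewrite setUC.
Qed.

Lemma mr_parA : associative (@mr_par X).
Proof.
move=> R S T; apply: multirel_ext => x A; split.
  move=> [B [E /= [RxB [C [D /= [SxC TxD ->]]] ->]]].
  by exists (B `|` C), D; split=> //; [exists B, C|rewrite setUA].
move=> [E [D /= [[B [C /= [RxB SxC ->]]] TxD ->]]].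
by exists B, (C `|` D); split=> //; [exists C, D|rewrite setUA].
Qed.

Lemma mr_par1x : left_id (@mr_pid X) (@mr_par X).
Proof.
move=> R; apply: multirel_ext => x A; split.
  by move=> [E [B /= [E0 RxB ->]]]; rewrite (E0 : E = set0) set0U.
by move=> RxA; exists set0, A; rewrite set0U.
Qed.

Lemma mr_parDr : right_distributive (@mr_par X) (@mr_union X).
Proof.
move=> R S T; apply: multirel_ext => x A; split.
  by move=> [B [C /= [RxB [SxC|TxC] ->]]]; [left|right]; exists B, C.
by move=> [] [B [C /= [RxB SxC ->]]]; exists B, C; split=> //; [left|right].
Qed.

Lemma mr_proto_trioid :
  proto_trioid (@mr_union X) (@mr_comp X) (@mr_par X)
    (@mr_empty X) (@mr_sid X) (@mr_pid X).
Proof.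
split.
- exact: mr_proto_dioid.
- exact: mr_parA.
- exact: mr_parC.
- exact: mr_par1x.
- exact: mr_parDr.
- by move=> R; apply: multirel_ext => x A; split=> // -[B [C []]].
Qed.

(** * Domain and antidomain axioms, read off from supports *)

Lemma mr_dp_trioid :
  dp_trioid (@mr_union X) (@mr_comp X) (@mr_par X)
    (@mr_empty X) (@mr_sid X) (@mr_pid X) (@mr_dom X).
Proof.
split.
- exact: mr_proto_trioid.
- by move=> R S T [U RST]; apply: mr_compA_of_test; exists (mr_support U).
- move=> R; apply/setUidPr => -[x A] RxA.
  by rewrite mr_domE; apply/mr_test_compP; split=> //; exists A.
- by move=> R S; rewrite !mr_domE mr_comp_support.
- by move=> R S; rewrite !mr_domE mr_support_union mr_test_union.
- by move=> R; apply/setUidPr => -[x A] [].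
- by apply: multirel_ext => x A; split=> // -[_ []].
- by move=> R S T; rewrite mr_domE mr_par_comp_test.
- by move=> R S; rewrite !mr_domE mr_support_par mr_test_comp.
- by move=> R S; rewrite !mr_domE mr_test_par mr_test_comp.
Qed.

Lemma mr_ap_trioid :
  ap_trioid (@mr_union X) (@mr_comp X) (@mr_par X)
    (@mr_empty X) (@mr_sid X) (@mr_pid X) (@mr_antidom X).
Proof.
split.
- exact: mr_proto_trioid.
- by move=> R S T [U RST]; apply: mr_compA_of_test; exists (~` mr_support U).
- move=> R; apply: multirel_ext => x A; rewrite mr_antidomE mr_test_compP.
  by split=> // -[nRx RxA]; apply: nRx; exists A.
(* The double complement cancels, which leaves the locality of supports. *)
- by move=> R S; rewrite !mr_antidomE mr_support_test setCK -mr_comp_support.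
- move=> R; rewrite !mr_antidomE mr_support_test setCK -mr_test_union setUC.
  by rewrite setUv mr_sidE.
- by move=> R S T; rewrite mr_antidomE mr_test_compDr.
- by move=> R S T; rewrite mr_antidomE mr_par_comp_test.
(* De Morgan turns the intersection of supports into a union of complements. *)
- by move=> R S; rewrite !mr_antidomE mr_support_par setCI mr_test_union.
- by move=> R S; rewrite !mr_antidomE mr_test_par mr_test_comp.
Qed.

End MultirelationAlgebra.

Theorem theorem6p1 (X : Type) :
  dp_trioid (@mr_union X) (@mr_comp X) (@mr_par X)
    (@mr_empty X) (@mr_sid X) (@mr_pid X) (@mr_dom X) /\
  ap_trioid (@mr_union X) (@mr_comp X) (@mr_par X)
    (@mr_empty X) (@mr_sid X) (@mr_pid X) (@mr_antidom X).
Proof. by split; [exact: mr_dp_trioid|exact: mr_ap_trioid]. Qed.
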